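(* Let $K$ be a field, let $I\subset R=K[x_1,\ldots,x_n]$ be a monomial ideal, let $\mathfrak{p}$ be a monomial prime ideal in $R$, let $t\geq 1$, let $\alpha_1,\ldots,\alpha_s$ be positive integers, and let $y_1,\ldots,y_s$ be distinct variables in $R$ (that is, distinct elements of $\{x_1,\ldots,x_n\}$) such that $\mathfrak{p}\notin \mathrm{Ass}(R/(I^t,y_1^{\alpha_1}))$ and, for each $i=2,\ldots,s$, $\mathfrak{p}\notin \mathrm{Ass}\bigl(R/((I^t:\prod_{j=1}^{i-1}y_j^{\alpha_j}),y_i^{\alpha_i})\bigr)$. Then: (i) $\mathfrak{p}\in \mathrm{Ass}(R/I^t)$ if and only if $\mathfrak{p}\in \mathrm{Ass}\bigl(R/(I^t:\prod_{i=1}^s y_i^{\alpha_i})\bigr)$. (ii) If $\prod_{i=1}^s y_i^{\alpha_i}\in I^\ell$ for some $\ell\geq t$, then $\mathfrak{p}\notin \mathrm{Ass}(R/I^t)$.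
   Context: For an ideal $Q$ of $R$ and $f\in R$, $(Q:f)=\{r\in R\mid rf\in Q\}$, and $(Q,f)$ denotes the ideal $Q+fR$. $\mathrm{Ass}(R/Q)$ is the set of associated primes of $Q$, i.e. the prime ideals of the form $(Q:f)$ with $f\in R$. A monomial prime ideal is an ideal generated by a subset of the variables. *)

(* Defs.v *)
From mathcomp Require Export all_boot all_order all_algebra.
From mathcomp Require Export boolp classical_sets.
From mathcomp Require Export mpoly.

Set Implicit Arguments.
Unset Strict Implicit.
Unset Printing Implicit Defensive.
Import GRing.Theory.
Local Open Scope classical_set_scope.
Local Open Scope ring_scope.

(* Ideals are classical sets [set R] rather than instances of [idealr]: the    *)
(* latter are proper by definition, whereas I^t, (Q : f) and (Q, f) may all be *)
(* the unit ideal.                                                             *)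

Definition ideal_gen (R : comNzRingType) (S : set R) : set R :=
  [set f | exists (k : nat) (a g : 'I_k -> R),
     (forall i, S (g i)) /\ f = \sum_(i < k) a i * g i].

Definition ideal_mul (R : comNzRingType) (I J : set R) : set R :=
  ideal_gen [set h | exists f g, [/\ I f, J g & h = f * g]].

Fixpoint ideal_exp (R : comNzRingType) (I : set R) (t : nat) : set R :=
  if t is t'.+1 then ideal_mul I (ideal_exp I t') else setT.

(* (Q : f) *)
Definition ideal_colon (R : comNzRingType) (Q : set R) (f : R) : set R :=
  [set r | Q (r * f)].

(* (Q, f) = Q + fR *)
Definition ideal_adjoin (R : comNzRingType) (Q : set R) (f : R) : set R :=
  [set h | exists q r, Q q /\ h = q + f * r].

(* [idealr_closed] includes 1 \notin P. *)
Definition prime_ideal (R : comNzRingType) (P : set R) : Prop :=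
  idealr_closed (mem P) /\ prime_idealr_closed (mem P).

(* Ass(R/Q) *)
Definition Ass (R : comNzRingType) (Q : set R) : set (set R) :=
  [set P | prime_ideal P /\ exists f, P = ideal_colon Q f].

Definition monomial_ideal (K : fieldType) (n : nat) (I : set {mpoly K[n]}) :
    Prop :=
  exists M : set 'X_{1..n}, I = ideal_gen [set 'X_[m] | m in M].

Definition monomial_prime (K : fieldType) (n : nat) (P : set {mpoly K[n]}) :
    Prop :=
  exists A : {set 'I_n}, P = ideal_gen [set 'X_i | i in [set` A]].

(* Main.v *)
Require Import Defs.
Import GRing.Theory.
Local Open Scope classical_set_scope.
Local Open Scope ring_scope.

(** Everything rests on one general fact about a prime [P], an ideal [Q] and an
    element [f] of a commutative ring: the exact sequence
      0 -> R/(Q : f) -> R/Q -> R/(Q, f) -> 0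
    (the first map being multiplication by [f]) gives
      Ass(R/(Q : f)) <= Ass(R/Q) <= Ass(R/(Q : f)) \/ Ass(R/(Q, f)).
    These inclusions are [Ass_colon_sub] and [Ass_split].  Hence, when [P] is
    not in Ass(R/(Q, f)), it is in Ass(R/Q) if and only if it is in
    Ass(R/(Q : f)).

    For (i), start from [I^t] and take the colon by [y_1 ^ alpha_1], then by
    [y_2 ^ alpha_2], and so on.  Since [((Q : f) : g) = (Q : f g)], the [i]-th
    hypothesis of non-membership is exactly what moves [P] across the [i]-th
    step.

    For (ii), the powers of an ideal decrease, so the product of the
    [y_i ^ alpha_i] lies in [I^t]; the colon ideal is then the unit ideal,
    which has no associated primes, and (i) concludes. *)

(** The unit ideal is allowed, as it occurs among colon ideals and powers. *)
Definition is_ideal {R : comNzRingType} (Q : set R) : Prop :=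
  [/\ Q 0, forall u v, Q u -> Q v -> Q (u + v) & forall a u, Q u -> Q (a * u)].

Lemma ideal_opp {R : comNzRingType} (Q : set R) (u : R) :
  is_ideal Q -> Q u -> Q (- u).
Proof. by case=> _ _ QM Qu; rewrite -mulN1r; apply: QM. Qed.

Lemma ideal_gen_ideal {R : comNzRingType} (S : set R) : is_ideal (ideal_gen S).
Proof.
split.
- by exists 0%N, (fun=> 0), (fun=> 0); split=> [[]//|]; rewrite big_ord0.
- move=> u v [k [a [g [Sg ->]]]] [l [b [h [Sh ->]]]].
  exists (k + l)%N,
    (fun i => match split i with inl j => a j | inr j => b j end),
    (fun i => match split i with inl j => g j | inr j => h j end).
  split=> [i|]; first by case: (split i).
  rewrite big_split_ord /=; congr (_ + _); apply: eq_bigr => i _.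
    by rewrite (unsplitK (inl i)).
  by rewrite (unsplitK (inr i)).
- move=> c u [k [a [g [Sg ->]]]]; exists k, (fun i => c * a i), g; split=> //.
  by rewrite big_distrr /=; apply: eq_bigr => i _; rewrite mulrA.
Qed.

Lemma ideal_gen_sub {R : comNzRingType} (S Q : set R) :
  is_ideal Q -> S `<=` Q -> ideal_gen S `<=` Q.
Proof.
case=> Q0 QD QM SQ _ [k [a [g [Sg ->]]]].
by apply: big_ind => // i _; apply/QM/SQ.
Qed.

Lemma ideal_exp_ideal {R : comNzRingType} (I : set R) (t : nat) :
  is_ideal (ideal_exp I t).
Proof. by case: t => [|t] //=; apply: ideal_gen_ideal. Qed.

(** Each power absorbs multiplication, in particular by the elements of [I]. *)
Lemma ideal_exp_anti {R : comNzRingType} (I : set R) (t l : nat) :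
  (t <= l)%N -> ideal_exp I l `<=` ideal_exp I t.
Proof.
move=> /subnK <-; elim: (l - t)%N => [//|k IHk].
apply: subset_trans IHk; rewrite addSn /=.
apply: ideal_gen_sub; first exact: ideal_exp_ideal.
move=> _ [f [g [_ Ig ->]]].
by have [_ _ QM] := ideal_exp_ideal I (k + t); apply: QM.
Qed.

Lemma ideal_colon_ideal {R : comNzRingType} (Q : set R) (f : R) :
  is_ideal Q -> is_ideal (ideal_colon Q f).
Proof.
case=> Q0 QD QM; split=> [|u v|a u]; rewrite /ideal_colon /= ?mul0r //.
  by rewrite mulrDl; apply: QD.
by rewrite -mulrA; apply: QM.
Qed.

Lemma ideal_colon1 {R : comNzRingType} (Q : set R) : ideal_colon Q 1 = Q.
Proof. by apply/seteqP; split=> r; rewrite /ideal_colon /= mulr1. Qed.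

Lemma ideal_colonM {R : comNzRingType} (Q : set R) (f g : R) :
  ideal_colon (ideal_colon Q f) g = ideal_colon Q (f * g).
Proof.
by apply/seteqP; split=> r; rewrite /ideal_colon /= -mulrA (mulrC g).
Qed.

Lemma Ass_colon_sub {R : comNzRingType} (Q : set R) (f : R) :
  Ass (ideal_colon Q f) `<=` Ass Q.
Proof.
by move=> P [primeP [g defP]]; split=> //; exists (f * g); rewrite -ideal_colonM.
Qed.

(** Write [P = (Q : g)].  The submodule of R/Q generated by [g] is isomorphic
    to the domain R/P, so all its nonzero elements have annihilator [P].  If one
    of them is a multiple of [f], then [P] is in Ass(R/(Q : f)); otherwise this
    submodule embeds into R/(Q, f), and [P] is in Ass(R/(Q, f)). *)
Lemma Ass_split {R : comNzRingType} (Q : set R) (f : R) :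
  is_ideal Q ->
  Ass Q `<=` Ass (ideal_colon Q f) `|` Ass (ideal_adjoin Q f).
Proof.
move=> Qideal P [primeP [g defP]]; have [Q0 QD QM] := Qideal.
have PE u : P u <-> Q (u * g) by rewrite defP.
have [_ mulP] := primeP.
case: (pselect (exists h r, ~ Q (h * g) /\ Q (h * g - f * r))).
- move=> [h [r [nQhg Qhr]]]; left; split=> //; exists r; rewrite ideal_colonM.
  (* modulo Q, f * r is the nonzero multiple h * g of g *)
  apply/seteqP; split=> u; rewrite /ideal_colon /=.
    move=> /PE Qug.
    have -> : u * (f * r) = h * (u * g) - u * (h * g - f * r).
      by rewrite mulrBr opprB [h * _]mulrCA addrC subrK.
    by apply: QD; [exact: QM | apply: ideal_opp => //; exact: QM].
  move=> Qufr; have : u * h \in P.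
    rewrite inE; apply/PE.
    have -> : u * h * g = u * (h * g - f * r) + u * (f * r).
      by rewrite mulrBr subrK mulrA.
    by apply: QD => //; exact: QM.
  by move=> /mulP/orP[]; rewrite inE // => /PE.
- move=> noMultiple; right; split=> //; exists g.
  apply/seteqP; split=> u; rewrite /ideal_colon /=.
    by move=> /PE Qug; exists (u * g), 0; rewrite mulr0 addr0.
  move=> [q [r [Qq ugE]]]; apply/PE.
  case: (pselect (Q (u * g))) => // nQug; case: noMultiple.
  by exists u, r; split=> //; rewrite ugE addrK.
Qed.

Lemma Ass_colonP {R : comNzRingType} (Q P : set R) (f : R) :
  is_ideal Q -> ~ Ass (ideal_adjoin Q f) P ->
  Ass Q P <-> Ass (ideal_colon Q f) P.
Proof.
move=> Qideal nAss; split; last exact: Ass_colon_sub.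
by move=> /(Ass_split Q f Qideal)[].
Qed.

(** For [i = 0] the product is empty, so the hypothesis says that [P] is not in
    Ass(R/(Q, f_0)). *)
Lemma Ass_colon_prodP {R : comNzRingType} (Q P : set R) (s : nat)
    (f : 'I_s -> R) :
  is_ideal Q ->
  (forall i : 'I_s,
     ~ Ass (ideal_adjoin
              (ideal_colon Q (\prod_(j < s | (j < i)%N) f j)) (f i)) P) ->
  Ass Q P <-> Ass (ideal_colon Q (\prod_(i < s) f i)) P.
Proof.
move=> Qideal nAss.
have step k : (k <= s)%N ->
    Ass Q P <-> Ass (ideal_colon Q (\prod_(j < s | (j < k)%N) f j)) P.
  elim: k => [_|k IHk lt_ks]; first by rewrite big_pred0 // ideal_colon1.
  rewrite (IHk (ltnW lt_ks)).
  have -> : \prod_(j < s | (j < k.+1)%N) f j =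
            (\prod_(j < s | (j < k)%N) f j) * f (Ordinal lt_ks).
    rewrite (bigD1 (Ordinal lt_ks)) //= mulrC; congr (_ * _).
    by apply: eq_bigl => j; rewrite -val_eqE /= ltnS ltn_neqAle andbC.
  rewrite -ideal_colonM; apply: Ass_colonP; first exact: ideal_colon_ideal.
  exact: (nAss (Ordinal lt_ks)).
rewrite (step s (leqnn s)).
suff -> : \prod_(j < s | (j < s)%N) f j = \prod_(j < s) f j by [].
by apply: eq_bigl => j; rewrite ltn_ord.
Qed.

(** If [f] is in [Q], every [(Q : f g)] contains 1, which no prime does. *)
Lemma Ass_colon_mem {R : comNzRingType} (Q P : set R) (f : R) :
  is_ideal Q -> Q f -> ~ Ass (ideal_colon Q f) P.
Proof.
move=> [_ _ QM] Qf [[[_ /negP P1 _] _] [g defP]]; apply: P1.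
by rewrite inE defP /ideal_colon /= mul1r; apply: QM.
Qed.

Theorem proposition3p4 (K : fieldType) (n : nat)
    (I p : set {mpoly K[n]})
    (hI : monomial_ideal I) (hp : monomial_prime p)
    (t : nat) (ht : (1 <= t)%N)
    (s : nat) (hs : (0 < s)%N)
    (alpha : 'I_s -> nat) (halpha : forall i, (0 < alpha i)%N)
    (y : 'I_s -> 'I_n) (hy : injective y)
    (hfirst : ~ Ass (ideal_adjoin (ideal_exp I t)
                       ('X_(y (Ordinal hs)) ^+ alpha (Ordinal hs))) p)
    (hrest : forall i : 'I_s, (0 < i)%N ->
       ~ Ass (ideal_adjoin
                (ideal_colon (ideal_exp I t)
                   (\prod_(j < s | (j < i)%N) 'X_(y j) ^+ alpha j))
                ('X_(y i) ^+ alpha i)) p) :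
  (Ass (ideal_exp I t) p <->
   Ass (ideal_colon (ideal_exp I t) (\prod_(i < s) 'X_(y i) ^+ alpha i)) p)
  /\
  ((exists2 l : nat, (t <= l)%N &
      ideal_exp I l (\prod_(i < s) 'X_(y i) ^+ alpha i)) ->
   ~ Ass (ideal_exp I t) p).
Proof.
have Qideal := ideal_exp_ideal I t.
have colonP : Ass (ideal_exp I t) p <->
    Ass (ideal_colon (ideal_exp I t) (\prod_(i < s) 'X_(y i) ^+ alpha i)) p.
  apply: Ass_colon_prodP => // i; case: (posnP i) => [i0|]; last exact: hrest.
  have -> : i = Ordinal hs by apply: val_inj.
  by rewrite big_pred0 // ideal_colon1.
split=> // -[l le_tl /(ideal_exp_anti I t l le_tl) prodQ] /colonP.
exact: Ass_colon_mem.
Qed.
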